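(* Every graph $G$ with average degree less than $4$ satisfies $\chi_u(G)\le \Delta(G)+1$, where $\Delta(G)$ is the maximum degree of $G$.
   Context: Graphs are finite, simple, with at least one vertex. A $k$-list assignment $L$ of a graph $G$ assigns to each vertex $v$ a set $L(v)$ of exactly $k$ colors. A proper $L$-list coloring is a map $c$ on $V(G)$ with $c(v)\in L(v)$ for all $v$ and $c(u)\ne c(v)$ for every edge $uv$. $G$ is uniquely $k$-list colorable (U$k$LC) if there exists a $k$-list assignment $L$ for which $G$ has exactly one proper $L$-list coloring. $G$ is uniquely $(k,t)$-list colorable if there is a $k$-list assignment $L$ with $\left|\bigcup_{v}L(v)\right|\le t$ for which $G$ has exactly one proper $L$-list coloring. For a positive integer $k$, $\chi_u(G,k)$ is the minimum $t$ such that $G$ is uniquely $(k,t)$-list colorable, and $\chi_u(G,k)=0$ if $G$ is not uniquely $k$-list colorable. The uniquely list chromatic number of $G$ is $\chi_u(G)=\max_{k\ge 1}\chi_u(G,k)$. *)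

(* Defs.v *)
(* World: Mathematical Components; [boolp] supplies excluded middle for the
   undecided propositions behind the minimum and the maximum. *)
From HB Require Import structures.
From mathcomp Require Import all_boot all_order all_algebra.
From mathcomp Require Import finmap boolp.

Set Implicit Arguments.
Unset Strict Implicit.
Unset Printing Implicit Defensive.

Import Order.TTheory GRing.Theory Num.Theory.

(* A finite simple graph is a symmetric irreflexive relation [e] on a finite
   vertex type [T]; these two properties are hypotheses of the theorem. *)

Definition degree (T : finType) (e : rel T) (v : T) : nat := #|[set u | e v u]|.

Definition max_degree (T : finType) (e : rel T) : nat := \max_(v : T) degree e v.

Definition avg_degree (T : finType) (e : rel T) : rat :=
  ((\sum_(v : T) degree e v)%N%:R / #|T|%:R)%R.

(* Colors are natural numbers: the lists are finite and the vertices finitely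
   many, so a countably infinite supply of colors is no restriction. *)
Definition list_assignment (T : finType) (k : nat) (L : T -> {fset nat}) : Prop :=
  forall v, #|` L v| = k.

Definition proper_list_coloring (T : finType) (e : rel T) (L : T -> {fset nat})
    (c : {ffun T -> nat}) : Prop :=
  (forall v, c v \in L v) /\ (forall u v, e u v -> c u <> c v).

Definition has_unique_coloring (T : finType) (e : rel T) (L : T -> {fset nat}) :
    Prop :=
  exists! c : {ffun T -> nat}, proper_list_coloring e L c.

Definition UkLC (T : finType) (e : rel T) (k : nat) : Prop :=
  exists L : T -> {fset nat}, list_assignment k L /\ has_unique_coloring e L.

Definition UktLC (T : finType) (e : rel T) (k t : nat) : Prop :=
  exists L : T -> {fset nat},
    [/\ list_assignment k L,
        #|` (\bigcup_(v in T) L v)%fset| <= t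
      & has_unique_coloring e L].

Lemma UkLC_ex_t (T : finType) (e : rel T) (k : nat) :
  UkLC e k -> exists t, `[< UktLC e k t >].
Proof.
move=> [L [kL uL]]; exists #|` (\bigcup_(v in T) L v)%fset|.
by apply/asboolP; exists L.
Qed.

(* The minimum t such that [UktLC e k t]; 0 if [e] is not uniquely k-list colorable. *)
Definition chi_u_k (T : finType) (e : rel T) (k : nat) : nat :=
  if pselect (UkLC e k) is left h then ex_minn (UkLC_ex_t h) else 0.

Lemma chi_u_k_le (T : finType) (e : rel T) (k : nat) :
  chi_u_k e k <= #|T| * k.
Proof.
rewrite /chi_u_k; case: pselect => // h; case: ex_minnP => m _ minm.
case: (h) => L [kL uL]; apply: minm; apply/asboolP; exists L; split=> //.
have -> : #|T| * k = \sum_(v : T) #|` L v|.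
  by under eq_bigr do rewrite kL; rewrite sum_nat_const.
elim/big_rec2: _ => [|v s A _ IH]; first by rewrite cardfs0.
rewrite cardfsU; apply: leq_trans (leq_subr _ _) _.
by rewrite leq_add2l.
Qed.

Lemma UkLC_le_card (T : finType) (e : rel T) (k : nat) :
  0 < #|T| -> UkLC e k -> k <= #|T|.
Proof.
move=> /card_gt0P[v _] [L [kL [c [[cL ce] cU]]]]; rewrite leqNgt; apply/negP => ltk.
pose used := [fset x in codom c]%fset.
have /fsubsetPn[a aL aN] : ~~ (L v `<=` used)%fset.
  apply/negP => /fsubset_leq_card; rewrite kL leqNgt => /negP; apply.
  apply: leq_ltn_trans ltk; rewrite card_fseq; apply: leq_trans (size_undup _) _.
  by rewrite size_codom.
have aN' u : c u <> a.
  by move=> E; move/negP: aN; apply; rewrite inE /= -E codom_f.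
pose c' := [ffun u => if u == v then a else c u].
have /cU /ffunP/(_ v) : proper_list_coloring e L c'.
  split=> [u|u w euw]; rewrite !ffunE.
    by case: eqP => [->|_].
  case: eqP => [uv|_]; case: eqP => [wv|_].
  - by case: (ce _ _ euw); rewrite uv wv.
  - by move/esym/aN'.
  - by move/aN'.
  - exact: ce.
by rewrite ffunE eqxx => /aN'.
Qed.

Definition is_chi_u_value (T : finType) (e : rel T) : pred nat :=
  fun m => `[< exists2 k, 0 < k & chi_u_k e k = m >].

Lemma chi_u_value_ex (T : finType) (e : rel T) : exists m, is_chi_u_value e m.
Proof. by exists (chi_u_k e 1); apply/asboolP; exists 1. Qed.

Lemma chi_u_value_le (T : finType) (e : rel T) (m : nat) :
  is_chi_u_value e m -> m <= #|T| * #|T|.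
Proof.
move=> /asboolP[k _ <-]; have le1 := chi_u_k_le e k.
have [T0|Tpos] := posnP #|T|; first by move: le1; rewrite T0.
case: (pselect (UkLC e k)) => [h|h]; last first.
  by rewrite /chi_u_k; case: pselect.
by apply: leq_trans le1 _; rewrite leq_mul2l (UkLC_le_card Tpos h) orbT.
Qed.

(* A genuine maximum over all k >= 1: [chi_u_value_ex] and [chi_u_value_le] show
   that the set of values is nonempty and bounded, so [ex_maxn] applies. *)
Definition chi_u (T : finType) (e : rel T) : nat :=
  ex_maxn (chi_u_value_ex e) (@chi_u_value_le T e).

(* Main.v *)
(* If a product of |E| linear forms x_u - x_v is nonzero at exactly one point of
   a grid with 3-element sides, then |E| >= 2|V|; hence average degree less than
   4 rules out k >= 3.  The case k = 1 is greedy coloring.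

   For k = 2, take a minimal vertex set S carrying 2-lists with a unique
   coloring.  S has no cut vertex, so every proper subset with at least two
   vertices has an ear in S.  If some cycle x, a, ..., y, b, ... has a chord xy
   with a, b nonadjacent, giving a and b the same color and each cycle vertex
   the list {its color, the color of its successor} yields uniqueness with
   Delta + 1 colors.  A cycle with an ear satisfying suitable nonadjacency
   conditions works similarly.  If no such configuration exists in S, then:
   a maximal clique containing a triangle must be all of S; if there is no
   triangle, a maximal biclique containing a 4-cycle must be all of S; with
   neither, every cycle is chordless and, thetas being excluded, S is a cycle.
   But cliques, bicliques and cycles never have a unique coloring from 2-lists.
   So some nonempty subset of S needs at most Delta + 1 colors, and it extends
   greedily to adjacent vertices. *)
Require Import Defs.
From HB Require Import structures.
From mathcomp Require Import all_boot all_order all_algebra.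
From mathcomp Require Import finmap boolp zify ring.

Set Implicit Arguments.
Unset Strict Implicit.
Unset Printing Implicit Defensive.

(** * Lists of size two *)

Section TwoLists.

Context (T : finType) (e : rel T).
Hypothesis esym : symmetric e.
Hypothesis eirr : irreflexive e.

Implicit Types (s : seq T) (S X A B K : {set T}) (c d : T -> nat) (P : pred nat).

Definition proper_on S c :=
  forall u v, u \in S -> v \in S -> e u v -> c u != c v.

(* With lists [{c v, d v}], every other coloring arises from the proper coloring
   [c] by switching a nonempty set [X] of vertices from [c] to [d]; [forced] says
   that each such switch creates a conflict. *)
Definition forced S c d :=
  forall X, X \subset S -> X != set0 ->
  exists u v, [/\ u \in X, v \in S, e u v & d u = if v \in X then d v else c v].

Definition unique2 P S := exists c d,
  [/\ proper_on S c, {in S, forall v, [&& P (c v), P (d v) & c v != d v]}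
    & forced S c d].

Lemma e_neq x y : e x y -> x != y.
Proof. by move=> exy; apply: contraTneq exy => ->; rewrite eirr. Qed.

Lemma free_color t (F : {set T}) c :
  #|F| < t -> exists2 a, a < t & {in F, forall u, c u != a}.
Proof.
move=> ltF.
have /subsetPn[a _ aN] : ~~ ([set: 'I_t] \subset [set i : 'I_t | [exists u in F, c u == i :> nat]]).
  apply/negP => /subset_leq_card; rewrite cardsT card_ord leqNgt => /negP; apply.
  case: t ltF => // t ltF.
  apply: leq_ltn_trans ltF; apply: leq_trans (leq_imset_card (fun u => inord (c u) : 'I_t.+1) F).
  apply/subset_leq_card/subsetP => i; rewrite inE => /exists_inP[u uF /eqP cu].
  by apply/imsetP; exists u => //; apply: val_inj; rewrite /= inordK cu.
exists a => // u uF; apply: contraNneq aN => E.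
by rewrite inE; apply/exists_inP; exists u => //; rewrite E.
Qed.

Lemma degree_le_max v : degree e v <= max_degree e.
Proof. exact: (leq_bigmax_cond (F := degree e)). Qed.

Lemma greedy_extend t A c0 : max_degree e < t ->
    proper_on A c0 -> {in A, forall v, c0 v < t} ->
  exists c, [/\ forall u v, e u v -> c u != c v, forall v, c v < t & {in A, c =1 c0}].
Proof.
move=> tD; move: {2}#|~: A| (leqnn #|~: A|) => n.
elim: n A c0 => [|n IH] A c0 leA prop lt0.
  have AT v : v \in A.
    by move: leA; rewrite leqn0 cards_eq0 => /eqP/setP/(_ v); rewrite !inE => /negbFE.
  by exists c0; split=> // [u v|v]; [apply: prop|apply: lt0].
have [AT|/set0Pn[v]] := eqVneq (~: A) set0.
  by apply: (IH A) => //; rewrite AT cards0.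
rewrite inE => vA.
have [a ltat aP] := free_color c0 (leq_ltn_trans (degree_le_max v) tD).
have neq x : x \in A -> (x == v) = false.
  by move=> xA; apply: contraNF vA => /eqP <-.
have := IH (v |: A) (fun u => if u == v then a else c0 u); case.
- rewrite -ltnS; apply: leq_trans leA; apply: proper_card.
  by apply/properP; split; [rewrite setCS subsetUr|exists v; rewrite !inE ?eqxx].
- move=> x y; rewrite !inE => /orP[/eqP->|xA] /orP[/eqP->|yA] exy.
  + by rewrite eirr in exy.
  + by rewrite eqxx neq // eq_sym; apply: aP; rewrite inE.
  + by rewrite eqxx neq //; apply: aP; rewrite inE esym.
  + by rewrite !neq //; apply: prop.
- by move=> x; rewrite !inE; case: eqP => //= _ /lt0.
move=> c [c1 c2 c3]; exists c; split=> // x xA.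
by rewrite c3 ?inE ?xA ?orbT // neq.
Qed.

Lemma unique2_add t S u v : max_degree e < t -> unique2 (gtn t) S ->
  u \in S -> v \notin S -> e u v -> unique2 (gtn t) (v |: S).
Proof.
move=> tD [c [d [prop cd fr]]] uS vS euv.
have [a ltat aP] := free_color c (leq_ltn_trans (degree_le_max v) tD).
have neq x : x \in S -> (x == v) = false.
  by move=> xS; apply: contraNF vS => /eqP <-.
exists (fun x => if x == v then a else c x), (fun x => if x == v then c u else d x).
split.
- move=> x y; rewrite !inE => /orP[/eqP->|xA] /orP[/eqP->|yA] exy.
  + by rewrite eirr in exy.
  + by rewrite eqxx neq // eq_sym; apply: aP; rewrite inE.
  + by rewrite eqxx neq //; apply: aP; rewrite inE esym.
  + by rewrite !neq //; apply: prop.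
- move=> x; rewrite !inE; have [-> _|_ xS] := eqVneq x v; last exact: cd.
  have /and3P[/= -> _ _] := cd _ uS.
  by rewrite ltat /= eq_sym; apply: aP; rewrite inE esym.
move=> X XS X0; have [XS0|XS0] := eqVneq (X :&: S) set0.
  have XvE x : x \in X -> x = v.
    move=> xX; have := subsetP XS _ xX; rewrite !inE => /orP[/eqP//|xS].
    by move/setP/(_ x): XS0; rewrite !inE xX xS.
  have vX : v \in X by case/set0Pn: X0 => x xX; rewrite -(XvE _ xX).
  exists v, u; split=> //; rewrite ?inE ?uS ?orbT // 1?esym //.
  rewrite eqxx neq //; case: ifP => // /XvE E; by rewrite -E uS in vS.
have [x [y [/setIP[xX xS] yS exy E]]] := fr _ (subsetIr X S) XS0.
exists x, y; split=> //; first by rewrite inE yS orbT.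
by rewrite !neq // E inE yS andbT.
Qed.

Lemma unique2_setU P S1 S2 : unique2 P S1 -> unique2 P S2 ->
  (forall u v, u \in S1 -> v \in S2 -> u != v /\ ~~ e u v) -> unique2 P (S1 :|: S2).
Proof.
move=> [c1 [d1 [p1 cd1 f1]]] [c2 [d2 [p2 cd2 f2]]] sep.
have S2N v : v \in S2 -> (v \in S1) = false.
  by move=> v2; apply/negP => v1; have [] := sep _ _ v1 v2; rewrite eqxx.
exists (fun v => if v \in S1 then c1 v else c2 v),
       (fun v => if v \in S1 then d1 v else d2 v); split.
- move=> u v; rewrite !inE => /orP[] uS /orP[] vS euv.
  + by rewrite uS vS; apply: p1.
  + by have [] := sep _ _ uS vS; rewrite euv.
  + by have [] := sep _ _ vS uS; rewrite esym euv.
  + by rewrite !S2N //; apply: p2.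
- move=> v; rewrite !inE => /orP[vS|vS]; first by rewrite vS; apply: cd1.
  by rewrite S2N //; apply: cd2.
move=> X XS X0; have [E0|] := eqVneq (X :&: S1) set0.
  have XS2 : X \subset S2.
    apply/subsetP => x xX; have := subsetP XS _ xX; rewrite inE => /orP[x1|//].
    by move/setP/(_ x): E0; rewrite !inE xX x1.
  have [u [v [uX vS euv E]]] := f2 _ XS2 X0.
  exists u, v; split=> //; first by rewrite inE vS orbT.
  by rewrite !S2N // (subsetP XS2).
move=> X1; have [u [v [/setIP[uX uS] vS euv E]]] := f1 _ (subsetIr X S1) X1.
exists u, v; split=> //; first by rewrite inE vS.
by rewrite uS vS E inE vS andbT.
Qed.

Lemma unique2_sep P S A : unique2 P S -> A \subset S ->
  (forall u v, u \in A -> v \in S :\: A -> ~~ e u v) -> unique2 P A.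
Proof.
move=> [c [d [p cd f]]] AS sep; exists c, d; split.
- by move=> u v uA vA; apply: p; apply: (subsetP AS).
- by move=> v /(subsetP AS); apply: cd.
move=> X XA X0; have [u [v [uX vS euv E]]] := f _ (subset_trans XA AS) X0.
exists u, v; split=> //; apply: contraLR euv => vA; apply: sep => //.
  exact: (subsetP XA).
by rewrite inE vA.
Qed.

Lemma unique2_cut P S A B v : unique2 P S -> A :|: B = S -> A :&: B = [set v] ->
  (forall x y, x \in A -> y \in B -> e x y -> x = v \/ y = v) ->
  unique2 P A \/ unique2 P B.
Proof.
move=> [c [d [p cd f]]] AB Iv sep.
have AS : A \subset S by rewrite -AB subsetUl.
have BS : B \subset S by rewrite -AB subsetUr.
have [/andP[vA vB]] : (v \in A) && (v \in B) by rewrite -in_setI Iv inE.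
have restr (C : {set T}) : C \subset S -> forced C c d -> unique2 P C.
  move=> CS fC; exists c, d; split=> //.
  - by move=> x y xC yC; apply: p; apply: (subsetP CS).
  - by move=> x /(subsetP CS); apply: cd.
have [/(restr _ AS)|NA] := pselect (forced A c d); first by left.
have [/(restr _ BS)|NB] := pselect (forced B c d); first by right.
have ext (C : {set T}) : ~ forced C c d -> exists X : {set T}, [/\ X \subset C, X != set0 &
     forall x y, x \in X -> y \in C -> e x y -> d x <> if y \in X then d y else c y].
  move=> nf; apply: contrapT => nex; apply: nf => X XC X0; apply: contrapT => nx.
  apply: nex; exists X; split=> // x y xX yC exy E; apply: nx; by exists x, y.
have [X [XA X0 XP]] := ext _ NA; have [Y [YB Y0 YP]] := ext _ NB.
have XS := subset_trans XA AS; have YS := subset_trans YB BS.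
have inv x : x \in A -> x \in B -> x = v.
  by move=> xA xB; apply/set1P; rewrite -Iv inE xA.
have [vX|vX] := boolP (v \in X); last first.
  have [x [y [xX yS exy E]]] := f _ XS X0; have xA := subsetP XA _ xX.
  move: (yS); rewrite -AB inE => /orP[yA|yB]; first by case: (XP x y).
  case: (sep _ _ xA yB exy) => Ev; first by rewrite -Ev xX in vX.
  by case: (XP x y) => //; rewrite Ev.
have [vY|vY] := boolP (v \in Y); last first.
  have [x [y [xX yS exy E]]] := f _ YS Y0; have xA := subsetP YB _ xX.
  move: (yS); rewrite -AB inE => /orP[yA|yB]; last by case: (YP x y).
  rewrite esym in exy.
  case: (sep _ _ yA xA exy) => Ev; last by rewrite -Ev xX in vY.
  by case: (YP x y) => //; rewrite 1?esym ?Ev // -Ev.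
have XYS : X :|: Y \subset S by rewrite subUset XS.
have XY0 : X :|: Y != set0 by apply/set0Pn; exists v; rewrite inE vX.
have [x [y [xX yS exy E]]] := f _ XYS XY0.
have XYA z : z \in A -> (z \in X :|: Y) = (z \in X).
  move=> zA; rewrite inE; apply/orb_idr => zY.
  by rewrite (inv z zA (subsetP YB _ zY)).
have XYB z : z \in B -> (z \in X :|: Y) = (z \in Y).
  move=> zA; rewrite inE; apply/orb_idl => zY.
  by rewrite (inv z (subsetP XA _ zY) zA).
have [ABx ABy] : (x \in A :|: B) /\ (y \in A :|: B) by rewrite AB (subsetP XYS) ?yS.
have [[xA yA]|[xB yB]] : (x \in A /\ y \in A) \/ (x \in B /\ y \in B).
  case/setUP: ABx => xA; case/setUP: ABy => yB; first by left.
  - by case: (sep _ _ xA yB exy) => Ev; [right|left]; rewrite Ev in xX xA yB *.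
  - rewrite esym in exy.
    by case: (sep _ _ yB xA exy) => Ev; [right|left]; rewrite Ev in xA yB *.
  - by right.
- by case: (XP x y) => //; rewrite -XYA // E XYA.
- by case: (YP x y) => //; rewrite -XYB // E XYB.
Qed.

Lemma unique2_all_switch S c d : proper_on S c -> proper_on S d -> S != set0 -> ~ forced S c d.
Proof.
move=> pc pd S0 f; have [u [v [uS vS euv]]] := f _ (subxx S) S0.
by rewrite vS; apply/eqP; apply: pd.
Qed.

Lemma next_head (x a : T) s : next (x :: a :: s) x = a.
Proof. by rewrite /= eqxx. Qed.

Lemma next_mid (x : T) s1 y b s2 : uniq (x :: s1 ++ y :: b :: s2) ->
  next (x :: s1 ++ y :: b :: s2) y = b.
Proof.
move=> U; rewrite -(next_rot (size (x :: s1)) U).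
by rewrite -cat_cons rot_size_cat cat_cons next_head.
Qed.

Lemma next_closed (s : seq T) X v : v \in s -> v \in X ->
  (forall x, x \in s -> x \in X -> next s x \in X) -> uniq s -> {subset s <= X}.
Proof.
move=> vs vX cl U y; rewrite -(fconnect_cycle (cycle_next U) vs) => /iter_findex <-.
suff /andP[] : (iter (findex (next s) v y) (next s) v \in s)
  && (iter (findex (next s) v y) (next s) v \in X) by [].
elim: (findex _ _ _) => [|n /andP[IHs IHX]] /=; first by rewrite vs.
by rewrite mem_next IHs cl.
Qed.

(* Coloring [a] and [b] alike and putting [d v = c (next s v)], a conflict-free
   switch is closed under [next], hence is the whole cycle; then [x], [y] clash. *)
Lemma chord_unique2 t x a s1 y b s2 (s := x :: a :: s1 ++ y :: b :: s2) :
    max_degree e < t -> uniq s -> cycle e s -> e x y -> ~~ e a b ->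
  unique2 (gtn t) [set z in s].
Proof.
move=> tD U cyc exy nab.
have [||c [cp ct cA]] := @greedy_extend t [set a; b] (fun=> 0) tD.
- move=> p q; rewrite !inE => /orP[] /eqP -> /orP[] /eqP -> epq.
  + by rewrite eirr in epq.
  + by rewrite epq in nab.
  + by rewrite esym epq in nab.
  + by rewrite eirr in epq.
- by move=> v _; apply: leq_ltn_trans tD.
have nx : next s x = a by apply: next_head.
have ny : next s y = b by apply: (@next_mid x (a :: s1)).
have xs : x \in s by rewrite mem_head.
have ys : y \in s by rewrite /s -!cat_cons mem_cat mem_head orbT.
exists c, (c \o next s); split.
- by move=> u v _ _; apply: cp.
- move=> v; rewrite inE => vs; apply/and3P.
  by split; [apply: ct|apply: ct|apply/cp/next_cycle].
move=> X Xs /set0Pn[v vX].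
have vs : v \in s by have := subsetP Xs _ vX; rewrite inE.
have [cl|] := pselect (forall z, z \in s -> z \in X -> next s z \in X).
  have sX := next_closed vs vX cl U.
  exists x, y; split; rewrite ?inE ?sX //; change (c (next s x) = c (next s y)).
  by rewrite nx ny !cA // !inE eqxx ?orbT.
move=> ncl; apply: contrapT => nex; apply: ncl => z zs zX; apply: contrapT => nz.
apply: nex; exists z, (next s z); split=> //.
- by rewrite inE mem_next.
- exact: next_cycle.
by case: (boolP (next s z \in X)) => // H; case: nz.
Qed.

(* The color alternates along [r = a :: u :: p], so that switching [u] forces all
   of the ear [p], while [d] sends each vertex of [p] back to its predecessor; the
   final conflict is between [w] and the last vertex of [p]. *)
Lemma ear_unique2 t u a s1 w b s2 q1 q
    (s := u :: a :: s1 ++ w :: b :: s2) (p := q1 :: q) (r := a :: u :: p) :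
    max_degree e < t -> uniq (s ++ p) -> cycle e s ->
    path e u p -> e (last u p) w ->
    (forall i j, i < size r -> j < size r -> odd i = odd j ->
       ~~ e (nth u r i) (nth u r j)) ->
    (forall i, i < size r -> odd i = odd (size p) -> ~~ e b (nth u r i)) ->
  unique2 (gtn t) [set z in s ++ p].
Proof.
move=> tD U cyc pp plast H1 H2.
have [Us psN Up] : [/\ uniq s, {in p, forall z, (z \in s) = false} & uniq p].
  move: (U); rewrite cat_uniq => /and3P[-> /hasPn H ->]; split=> // z zp.
  by apply/negbTE/H.
have us : u \in s by rewrite mem_head.
have as_ : a \in s by rewrite !inE eqxx orbT.
have ws : w \in s by rewrite /s -!cat_cons mem_cat mem_head orbT.
have bs : b \in s by rewrite /s -!cat_cons mem_cat !inE eqxx !orbT.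
have spN z : z \in s -> (z \in p) = false.
  by move=> zs; apply/negP => /psN; rewrite zs.
have eua : e u a by case/andP: cyc.
have Ur : uniq r.
  rewrite /r cons_uniq in_cons negb_or eq_sym (e_neq eua) spN //.
  by rewrite cons_uniq spN.
have bu : b != u.
  apply: contraTneq Us => E; rewrite /s E /= !inE !mem_cat !inE.
  by rewrite eqxx !orbT.
have br : b \notin r.
  rewrite in_cons (in_cons u) spN // (negPf bu) !orbF.
  apply: contraTneq Us => E; rewrite /s E /= mem_cat !inE.
  by rewrite eqxx !orbT /= andbF.
have t1 : 1 < t.
  apply: leq_ltn_trans tD; apply: leq_trans (degree_le_max u).
  by apply/card_gt0P; exists a; rewrite inE.
pose c0 z : nat := if z \in r then odd (index z r) else odd (size p).
have [||c [cp ct cA]] := @greedy_extend t [set z in b :: r] c0 tD.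
- move=> x y; rewrite inE [x \in _]in_cons inE [y \in _]in_cons /c0.
  move=> /orP[/eqP->|xr] /orP[/eqP->|yr] exy.
  + by rewrite eirr in exy.
  + rewrite yr (negPf br); apply: contraTneq exy.
    case: (odd (size p)) (H2 (index y r)) => h;
    by case O: (odd _) => // _; rewrite -{1}(nth_index u yr) h ?index_mem // O.
  + rewrite xr (negPf br); rewrite esym in exy; apply: contraTneq exy.
    case: (odd (size p)) (H2 (index x r)) => h;
    by case O: (odd _) => // _; rewrite -{1}(nth_index u xr) h ?index_mem // O.
  + rewrite xr yr; apply: contraTneq exy => E.
    rewrite -(nth_index u xr) -(nth_index u yr) H1 ?index_mem //.
    by move: E; do 2!case: odd.
- by move=> v _; apply: leq_ltn_trans t1; rewrite /c0; case: ifP => _; apply: leq_b1.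
have cr i : i < size r -> c (nth u r i) = odd i.
  move=> ir; have nr := mem_nth u ir.
  by rewrite cA /c0 ?nr ?index_uniq // in_set in_cons nr orbT.
have cb : c b = odd (size p) by rewrite cA /c0 ?(negPf br) // in_set mem_head.
have na : next s u = a by apply: next_head.
have nb : next s w = b by apply: (@next_mid u (a :: s1)).
have pe i : i < size p -> e (nth u (u :: p) i) (nth u p i) by apply/pathP.
have ms i : i < size p -> nth u (u :: p) i \in s ++ p.
  rewrite mem_cat => ip; apply/orP; case: i ip => [_|i ip]; first by left.
  by right; apply: (mem_nth u (ltnW ip)).
have mp i : i < size p -> nth u p i \in s ++ p.
  by move=> ip; rewrite mem_cat mem_nth // orbT.
pose d z := if z \in p then c (nth u (u :: p) (index z p)) else c (next s z).
have dp i : i < size p -> d (nth u p i) = c (nth u (u :: p) i).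
  by move=> ip; rewrite /d mem_nth // index_uniq.
have ds z : z \in s -> d z = c (next s z) by move=> zs; rewrite /d spN.
exists c, d; split.
- by move=> x y _ _; apply: cp.
- move=> v; rewrite inE mem_cat => /orP[vs|vp].
    by rewrite ds //; apply/and3P; split; [apply: ct|apply: ct|apply/cp/next_cycle].
  rewrite -(nth_index u vp) dp ?index_mem //; apply/and3P.
  by split; [apply: ct|apply: ct|apply: cp; rewrite esym pe ?index_mem].
move=> X Xs X0.
have conf x y : x \in X -> y \in s ++ p -> e x y -> y \notin X -> d x = c y ->
    exists x y, [/\ x \in X, y \in [set z in s ++ p], e x y
                & d x = if y \in X then d y else c y].
  by move=> xX yS exy yX E; exists x, y; split; rewrite ?inE // (negPf yX).
have [[v vX vs]|Xs0] := pselect (exists2 v, v \in X & v \in s); last first.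
  have hX : has (mem X) p.
    case/set0Pn: X0 => x xX; apply/hasP; exists x => //.
    have := subsetP Xs _ xX; rewrite inE mem_cat => /orP[] // xs.
    by case: Xs0; exists x.
  have ip := hX; rewrite has_find in ip; set i := find _ _ in ip.
  apply: (conf (nth u p i) (nth u (u :: p) i)); rewrite ?ms ?dp //.
  - exact: (nth_find u hX).
  - by rewrite esym pe.
  case E: i => [|j] /=; first by apply/negP => uX; apply: Xs0; exists u.
  by apply/negP => jX; have := @before_find _ u (mem X) p j; rewrite -/i E ltnSn /= jX => /(_ isT).
have [cl|ncl] := pselect (forall z, z \in s -> z \in X -> next s z \in X); last first.
  apply: contrapT => nex; apply: ncl => z zs zX; apply: contrapT => nz; apply: nex.
  apply: (conf z (next s z)) => //; rewrite ?ds ?mem_cat ?mem_next ?zs ?next_cycle //.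
  exact/negP.
have sX := next_closed vs vX cl Us.
have [aX|] := boolP (all (mem X) p).
  exists (last u p), w; split=> //.
  - by apply: (allP aX); rewrite /p /= mem_last.
  - by rewrite inE mem_cat ws.
  rewrite sX // (ds w) // nb cb -nth_last /=.
  rewrite -[nth _ _ _]/(nth u p (size q)) dp // -(cr (size p)) ?ltnS //.
rewrite -has_predC => hX; have ip := hX; rewrite has_find in ip; set i := find _ _ in ip.
apply: (conf (nth u (u :: p) i) (nth u p i)); rewrite ?mp ?pe //.
- case E: i => [|j] /=; first exact: sX.
  have := @before_find _ u (predC (mem X)) p j; rewrite -/i E ltnSn => /(_ isT) /=.
  by move/negbFE.
- exact: (nth_find u hX).
rewrite -[nth u p i]/(nth u r i.+2) cr ?ltnS //.
case E: i ip => [|j] ip; first by rewrite [nth _ _ _]/= (ds u) // na (cr 0).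
change (d (nth u p j) = odd j.+3); rewrite dp ?(ltnW ip) // 2!oddS negbK.
by rewrite -(cr j.+1) // !ltnS ltnW // ltnW.
Qed.

(* Each [d v] is the color of a unique vertex [f v]; a minimal nonempty [f]-stable
   set, on which [f] is injective, can be switched. *)
Lemma clique_not_forced S c d : proper_on S c -> S != set0 ->
  {in S &, forall x y, x != y -> e x y} -> ~ forced S c d.
Proof.
move=> pc S0 cl fr.
have ex v : exists u, v \in S -> [/\ u \in S, u != v & d v = c u].
  have [vS|] := boolP (v \in S); last by exists v.
  have [||x [y [/set1P -> yS evy E]]] := fr [set v]; first by rewrite sub1set.
    by apply/set0Pn; exists v; rewrite set11.
  exists y => _; have yv : y != v by rewrite eq_sym e_neq.
  by rewrite E in_set1 (negPf yv); split.
have [f fP] := boolp.choice ex.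
have [X /minsetP[/and3P[X0 XS fX] minX] _] :
    {X | minset (fun X => [&& X != set0, X \subset S & f @: X \subset X]) X & X \subset S}.
  apply: minset_exists; rewrite S0 subxx; apply/subsetP => _ /imsetP[x xS ->].
  by case: (fP _ xS).
have fXX : f @: X = X.
  apply: minX => //; apply/and3P; split; [|exact: subset_trans fX XS|exact: imsetS].
  by case/set0Pn: X0 => x xX; apply/set0Pn; exists (f x); apply: imset_f.
have finj : {in X &, injective f} by apply/imset_injP; rewrite fXX.
have cinj : {in S &, injective c}.
  move=> x y xS yS E; apply/eqP; apply: contraTT (eqxx (c x)) => nxy.
  by rewrite {2}E pc // cl.
have [u [v [uX vS euv]]] := fr _ XS X0.
have uS := subsetP XS _ uX; have [fuS _ ->] := fP _ uS.
case: ifP => vX.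
  have [fvS _ ->] := fP _ vS => /(cinj _ _ fuS fvS)/(finj _ _ uX vX) E.
  by rewrite E eirr in euv.
by move/(cinj _ _ fuS vS) => E; rewrite -E -fXX imset_f in vX.
Qed.

Lemma biclique_not_forced S A B c d : proper_on S c -> A :|: B = S ->
    A != set0 -> {in A & B, forall x y, e x y} ->
    {in A &, forall x y, ~~ e x y} -> {in B &, forall x y, ~~ e x y} ->
  ~ forced S c d.
Proof.
move=> pc AB A0 eAB eA eB fr.
have AS : A \subset S by rewrite -AB subsetUl.
have BS : B \subset S by rewrite -AB subsetUr.
have single v : v \in S -> exists u, [/\ u \in S, e v u & d v = c u].
  move=> vS; have [||x [y [/set1P -> yS evy E]]] := fr [set v].
  - by rewrite sub1set.
  - by apply/set0Pn; exists v; rewrite set11.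
  by exists y; split=> //; rewrite E in_set1 eq_sym (negPf (e_neq evy)).
have nbrA v : v \in A -> exists2 u, u \in B & d v = c u.
  move=> vA; have [u [uS evu E]] := single _ (subsetP AS _ vA).
  exists u => //; move: uS; rewrite -AB inE => /orP[uA|//].
  by rewrite (negPf (eA _ _ vA uA)) in evu.
have nbrB v : v \in B -> exists2 u, u \in A & d v = c u.
  move=> vB; have [u [uS evu E]] := single _ (subsetP BS _ vB).
  exists u => //; move: uS; rewrite -AB inE => /orP[//|uB].
  by rewrite (negPf (eB _ _ vB uB)) in evu.
have S0 : S != set0.
  by case/set0Pn: A0 => x xA; apply/set0Pn; exists x; apply: (subsetP AS).
have key x y : x \in A -> y \in B -> d x != d y.
  move=> /nbrA[x' x'B ->] /nbrB[y' y'A ->].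
  by rewrite pc ?(subsetP AS _ y'A) ?(subsetP BS _ x'B) // esym eAB.
apply: unique2_all_switch pc _ S0 fr => x y.
rewrite -AB !inE => /orP[xA|xB] /orP[yA|yB] exy.
- by rewrite (negPf (eA _ _ xA yA)) in exy.
- exact: key.
- by rewrite eq_sym key.
- by rewrite (negPf (eB _ _ xB yB)) in exy.
Qed.

Definition chordless x0 (s : seq T) := forall i j, i < size s -> j < size s ->
  e (nth x0 s i) (nth x0 s j) ->
  [\/ j = i.+1, i = j.+1, i = 0 /\ j.+1 = size s | j = 0 /\ i.+1 = size s].

Lemma chordless_rev x0 s : chordless x0 s -> chordless x0 (rev s).
Proof.
move=> ch i j; rewrite size_rev => ln lj; rewrite !nth_rev // => exy.
have {exy}[||E|E|[E F]|[E F]] := ch _ _ _ _ exy; try lia.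
- by apply: Or42; lia.
- by apply: Or41; lia.
- by apply: Or44; lia.
- by apply: Or43; lia.
Qed.

Lemma chordless_step x0 s S c d : uniq s -> chordless x0 s -> S =i s ->
    forced S c d -> {in S, forall v, c v != d v} ->
    d (nth x0 s 0) = d (last x0 s) ->
  forall i, i.+1 < size s -> d (nth x0 s i) = c (nth x0 s i.+1).
Proof.
move=> U ch Ss fr cd E0; elim/ltn_ind => i IH ln.
have inX k : k < size s -> (nth x0 s k \in [set z in take i.+1 s]) = (k <= i).
  by move=> lk; rewrite inE in_take ?mem_nth // index_uniq.
have [||u [v [uX vS]]] := fr [set z in take i.+1 s].
- by apply/subsetP => z; rewrite inE Ss; apply: mem_take.
- apply/set0Pn; exists (nth x0 s 0); rewrite inX //; lia.
have us : u \in s by move: uX; rewrite inE; apply: mem_take.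
have vs : v \in s by rewrite -Ss.
have lu : index u s < size s by rewrite index_mem.
have lv : index v s < size s by rewrite index_mem.
rewrite -(nth_index x0 us) -(nth_index x0 vs) in uX *.
move: (index u s) (index v s) lu lv uX => j k lj lk; rewrite !inX // => ji exy.
have cdk l : l < size s -> c (nth x0 s l) != d (nth x0 s l).
  by move=> ll; apply: cd; rewrite Ss mem_nth.
case: ifP => ki E; case: (ch _ _ lj lk exy) => [F|F|[F G]|[F G]]; try lia.
- subst k; move: (IH j ki ltac:(lia)) (cdk _ lk); rewrite E => ->.
  by rewrite eqxx.
- subst j; move: (IH k ji ltac:(lia)) (cdk _ lj); rewrite -E => ->.
  by rewrite eqxx.
- by have -> : i = j by [lia]; rewrite E F.
- subst j; move: (cdk _ lk); rewrite -E E0 -nth_last.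
  by have -> : k = (size s).-1 by [lia]; rewrite eqxx.
Qed.

(* Here [d] must follow [c] in both directions along the path from the first to
   the last vertex, so [c] alternates between two colors; the equation between the
   ends then contradicts the parity of the cycle. *)
Lemma chordless_ends x0 s S c d : uniq s -> 2 < size s -> cycle e s ->
    chordless x0 s -> S =i s -> proper_on S c -> {in S, forall v, c v != d v} ->
    d (nth x0 s 0) = d (last x0 s) ->
  ~ forced S c d.
Proof.
move=> U s2 cyc ch Ss pc cd E0 fr.
have up := chordless_step U ch Ss fr cd E0.
have down i : i.+1 < size s -> d (nth x0 s i.+1) = c (nth x0 s i).
  have rev_Ss : S =i rev s by move=> z; rewrite mem_rev.
  have rev_E0 : d (nth x0 (rev s) 0) = d (last x0 (rev s)).
    rewrite -nth_last !nth_rev ?size_rev; try lia.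
    by rewrite subn1 nth_last -E0; do 2!f_equal; lia.
  have revU : uniq (rev s) by rewrite rev_uniq.
  have := chordless_step revU (chordless_rev ch) rev_Ss fr cd rev_E0.
  move=> /(_ (size s - i.+2)); rewrite size_rev => H li; move: H.
  rewrite !nth_rev; try lia.
  have -> : size s - (size s - i.+2).+1 = i.+1 by lia.
  have -> : size s - (size s - i.+2).+2 = i by lia.
  by apply; lia.
have par i : i < size s -> c (nth x0 s i) = c (nth x0 s (odd i)).
  elim/ltn_ind: i => -[|[|i]] IH li //.
  rewrite [odd _.+2]/= negbK -IH //; last lia.
  by rewrite -up // -down //; lia.
have mS i : i < size s -> nth x0 s i \in S by move=> li; rewrite Ss mem_nth.
have n01 : c (nth x0 s 0) != c (nth x0 s 1).
  apply: pc; rewrite ?mS //; try lia.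
  by case: s s2 cyc {U ch Ss E0 up down par mS} => [|x [|y s]] //= _ /andP[].
have nlast : c (last x0 s) != c (nth x0 s 0).
  rewrite -nth_last; apply: pc; rewrite ?mS //; try lia.
  rewrite nth_last; case: s s2 cyc {U ch Ss E0 up down par mS n01} => //= x s _.
  by rewrite rcons_path => /andP[].
move: nlast n01 E0; rewrite up //; last lia.
rewrite -nth_last; have -> : (size s).-1 = (size s - 2).+1 by lia.
rewrite down; last lia.
rewrite (par (size s - 2)); last lia.
rewrite (par (size s - 2).+1); last lia.
by rewrite [odd _.+1]/=; case: odd => /= N1 N2 E; move: N1 N2; rewrite ?E eqxx.
Qed.

Lemma chordless_cycle_not_forced s S c d : uniq s -> 2 < size s -> cycle e s ->
    (forall x0 k, chordless x0 (rot k s)) -> S =i s -> proper_on S c ->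
    {in S, forall v, c v != d v} ->
  ~ forced S c d.
Proof.
move=> U s2 cyc ch Ss pc cd fr.
have ends x0 k : k < size s -> d (nth x0 (rot k s) 0) = d (last x0 (rot k s)) -> False.
  move=> lk E.
  apply: (chordless_ends _ _ _ (ch x0 k) _ pc cd E fr); rewrite ?rot_uniq ?size_rot ?rot_cycle //.
  by move=> z; rewrite mem_rot.
have [||x [y [xS yS exy]]] := fr S; first exact: subxx.
  by apply/set0Pn; case: s Ss s2 {U cyc ch ends} => // z s Ss _; exists z; rewrite Ss mem_head.
rewrite yS; rewrite !Ss in xS yS.
have li : index x s < size s by rewrite index_mem.
have lj : index y s < size s by rewrite index_mem.
rewrite -(nth_index x xS) -(nth_index x yS) in exy *.
move: (index x s) (index y s) li lj exy => i j li lj exy.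
have consec k : k.+1 < size s -> d (nth x s k) = d (nth x s k.+1) -> False.
  move=> lk E; apply: (ends x k.+1) => //; rewrite /rot nth_cat size_drop subn_gt0 lk.
  rewrite nth_drop addn0 -E last_cat -[last _ (take _ _)]nth_last size_take lk.
  by rewrite nth_take // (set_nth_default x) // ltnW.
have wrap : d (nth x s 0) = d (nth x s (size s).-1) -> False.
  by rewrite nth_last => E; apply: (ends x 0); rewrite ?rot0 //; lia.
move=> E; have := ch x 0; rewrite rot0 => /(_ _ _ li lj exy) [F|F|[F G]|[F G]].
- by apply: (consec i); rewrite -F.
- by apply: (consec j); rewrite -F.
- by apply: wrap; rewrite -G /= -F.
- by apply: wrap; rewrite -G /= -F.
Qed.

Lemma ear_exists P S K : unique2 P S ->
    (forall A, A \proper S -> A != set0 -> ~ unique2 P A) ->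
    K \proper S -> 1 < #|K| ->
  exists u w q1 q, [/\ u \in K, w \in K & u != w] /\
    [/\ path e u (q1 :: q), e (last q1 q) w, uniq (q1 :: q)
      & {subset q1 :: q <= S :\: K}].
Proof.
move=> US minS KpS K1; have KS := proper_sub KpS.
have K0 : K != set0 by rewrite -card_gt0 ltnW.
have [[u [q [uK qSK euq]]]|nq] :=
    pselect (exists u q, [/\ u \in K, q \in S :\: K & e u q]); last first.
  case: (minS K KpS K0); apply: unique2_sep US KS _ => u q uK qSK.
  by apply/negP => euq; apply: nq; exists u, q.
pose R := [rel x y | [&& e x y, x \in S :\: K & y \in S :\: K]].
pose Q := [set z | connect R q z].
have qQ : q \in Q by rewrite inE connect0.
have QSK z : z \in Q -> z \in S :\: K.
  rewrite inE => /connectP[p]; case/lastP: p => [_ -> //|p x].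
  by rewrite rcons_path last_rcons => /andP[_ /and3P[_ _ xS]] ->.
have [[z [w [zQ wK wu ezw]]]|nz] :=
    pselect (exists z w, [/\ z \in Q, w \in K, w != u & e z w]); last first.
  have uQ : u \notin Q by apply/negP => /QSK; rewrite inE uK.
  have uS := subsetP KS _ uK; have qS : q \in S by case/setDP: qSK.
  have QS : Q \subset S by apply/subsetP => z /QSK /setDP[].
  have AB : (u |: Q) :|: (S :\: Q) = S.
    apply/setP => x; rewrite !inE; have [->|_] /= := eqVneq x u; first by rewrite uS.
    by case xQ: (connect R q x) => //=; rewrite (subsetP QS) // inE.
  have IAB : (u |: Q) :&: (S :\: Q) = [set u].
    apply/setP => x; rewrite in_setI in_setU1 in_setD in_set1.
    have [->|_] /= := eqVneq x u; first by rewrite uQ uS.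
    by case: (x \in Q).
  have sep x y : x \in u |: Q -> y \in S :\: Q -> e x y -> x = u \/ y = u.
    case/setU1P => [->|xQ] /setDP[yS yQ] exy; first by left.
    right; apply/eqP; apply: contraNT yQ => yu.
    have [yK|yK] := boolP (y \in K); first by case: nz; exists x, y.
    have ySK : y \in S :\: K by rewrite inE yK.
    move: (xQ); rewrite inE => /connect_trans; rewrite inE; apply; apply: connect1.
    by rewrite /= exy QSK.
  have [w wK wu] : exists2 w, w \in K & w != u.
    have : 0 < #|K :\ u| by move: K1; rewrite (cardsD1 u) uK.
    by case/card_gt0P => w /setD1P[]; exists w.
  have [H|H] := unique2_cut US AB IAB sep; exfalso; apply: (minS _ _ _ H).
  - apply/properP; split; first by apply: subset_trans (subsetUl _ (S :\: Q)) _; rewrite AB.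
    exists w; first exact: (subsetP KS).
    by rewrite in_setU1 (negPf wu); apply/negP => /QSK; rewrite inE wK.
  - by apply/set0Pn; exists u; rewrite setU11.
  - by apply/properP; split; [rewrite subsetDl|exists q => //; rewrite in_setD qQ].
  - by apply/set0Pn; exists u; rewrite in_setD uQ.
move: zQ ezw; rewrite inE => /connectP[p0 pp0 ->]; case/shortenP: pp0 => p pp Up _ elw.
exists u, w, q, p; split; first by split=> //; rewrite eq_sym.
split=> //; first by rewrite /= euq; apply: sub_path pp => x y /andP[].
move=> x; rewrite inE => /predU1P[-> //|].
elim: p q pp {qSK euq Q qQ QSK Up elw p0} => //= y p IH q /andP[/and3P[_ _ yS] pp].
by rewrite inE => /predU1P[-> //|]; apply: IH pp.
Qed.

Lemma uniq_insert (x : T) p r : uniq (x :: r) -> uniq p ->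
  (forall v, v \in x :: r -> v \notin p) -> uniq (x :: p ++ r).
Proof.
rewrite cons_uniq => /andP[xr Ur] Up N; rewrite cons_uniq mem_cat negb_or N ?mem_head // xr.
rewrite cat_uniq Up Ur andTb andbT; apply/hasPn => v vr.
by apply: N; rewrite in_cons vr orbT.
Qed.

Lemma cycle_of_paths u p w r : path e u p -> e (last u p) w ->
  path e w r -> e (last w r) u -> cycle e (u :: p ++ w :: r).
Proof. by move=> up pw wr ru; rewrite /= rcons_cat cat_path up /= pw rcons_path wr. Qed.

Definition barren t S := forall A, A \subset S -> A != set0 -> ~ unique2 (gtn t) A.

Definition minimal_unique2 S := unique2 predT S /\
  forall A, A \proper S -> A != set0 -> ~ unique2 predT A.

Lemma barren_chord t S x a s1 y b s2 (s := x :: a :: s1 ++ y :: b :: s2) :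
    max_degree e < t -> barren t S -> uniq s -> {subset s <= S} -> cycle e s ->
  e x y -> e a b.
Proof.
move=> tD bS U sS cyc exy; apply: contrapT => /negP nab.
apply: (bS _ _ _ (chord_unique2 tD U cyc exy nab)).
  by apply/subsetP => z; rewrite inE; apply: sS.
by apply/set0Pn; exists x; rewrite inE mem_head.
Qed.

Lemma barren_triangle_free t S x y z : max_degree e < t -> barren t S ->
    minimal_unique2 S -> x \in S -> y \in S -> z \in S ->
  e x y -> e y z -> e z x -> False.
Proof.
move=> tD bS mS xS yS zS exy eyz ezx; have [US minS] := mS.
pose clique K := (K \subset S) &&
  [forall x in K, forall y in K, (x != y) ==> e x y].
have [K /maxsetP[/andP[KS cK] maxK] xyzK] :
    {K | maxset clique K & [set x; y; z] \subset K}.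
  apply: maxset_exists; apply/andP; split.
    by apply/subsetP => v; rewrite !inE -orbA => /or3P[] /eqP->.
  apply/forall_inP => u uK; apply/forall_inP => v vK; apply/implyP.
  move: uK vK; rewrite !inE -!orbA.
  by do 2!(move=> /or3P[] /eqP->); rewrite ?eqxx // 1?esym.
have {}cK : {in K &, forall x y, x != y -> e x y}.
  by move=> u v uK vK; apply/implyP; move/forall_inP: cK => /(_ _ uK)/forall_inP; apply.
have K3 : 2 < #|K|.
  apply: leq_trans (subset_leq_card xyzK).
  rewrite (cardsD1 z) !inE eqxx !orbT (cardsD1 y) !inE eqxx !orbT (e_neq eyz).
  rewrite (cardsD1 x) !inE eqxx eq_sym (e_neq exy) (eq_sym x) (e_neq ezx) //.
have K0 : K != set0 by rewrite -card_gt0 (leq_trans _ K3).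
have KpS : K \proper S.
  rewrite properEneq KS andbT; apply/eqP => E.
  by case: US => c [d [pc _ fr]]; apply: clique_not_forced pc _ _ fr; rewrite -E.
have one q u w : q \in S :\: K -> u \in K -> w \in K -> e q u -> e q w -> u = w.
  case/setDP => qS qK uK wK equ eqw; apply/eqP; apply: contraT => uw.
  have [z' z'K nqz] : exists2 z', z' \in K & ~~ e q z'.
    apply: contrapT => nex; have H v : v \in K -> e q v.
      by move=> vK; apply: contrapT => /negP nqv; apply: nex; exists v.
    move: qK; rewrite -(maxK (q |: K)) ?setU11 ?subsetUr //; apply/andP; split.
      by rewrite subUset sub1set qS.
    apply/forall_inP => v /setU1P vK; apply/forall_inP => v' /setU1P v'K.
    apply/implyP; case: vK v'K => [->|vK] [->|v'K]; rewrite ?eqxx //.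
    - by move=> _; apply: H.
    - by move=> _; rewrite esym; apply: H.
    - exact: cK.
  have uz : u != z' by apply: contraNneq nqz => <-.
  have wz : w != z' by apply: contraNneq nqz => <-.
  have qu := e_neq equ; have qw := e_neq eqw.
  have qz : q != z' by apply: contraNneq qK => ->.
  case/negP: nqz; rewrite esym; apply: (@barren_chord t S u z' [::] w q [::]) => //.
  - by rewrite /= !inE !negb_or; do ?[apply/andP; split]; rewrite // eq_sym.
  - by move=> v; rewrite !inE => /or4P[] /eqP->; rewrite // (subsetP KS).
  - have zw : z' != w by rewrite eq_sym.
    by rewrite /= (cK u z') // (cK z' w) //= (esym w) eqw equ.
  - exact: cK.
have [u [w [q1 [q [[uK wK uw] [pq lq Uq qSK]]]]]] :=
  ear_exists US minS KpS (ltnW K3).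
have [z' z'K] : exists z', z' \in K :\ u :\ w.
  apply/card_gt0P; move: K3.
  by rewrite (cardsD1 u) uK (cardsD1 w) in_setD1 eq_sym uw wK.
move: z'K; rewrite !inE => /and3P[zw zu z'K].
have e1 : e q1 z'.
  apply: (@barren_chord t S u q1 q w z' [::]) => //.
  - apply: (uniq_insert (r := [:: w; z'])) Uq _ => [|v].
      by rewrite /= !inE !negb_or; do ?[apply/andP; split]; rewrite // eq_sym.
    rewrite !inE => H; apply/negP => /qSK /setDP[_ /negP]; apply.
    by case/or3P: H => /eqP->.
  - move=> v; rewrite in_cons -cat_cons mem_cat !in_cons orbF.
    move=> /or4P[/eqP->|/qSK/setDP[] //|/eqP->|/eqP->]; exact: (subsetP KS).
  - apply: (cycle_of_paths (p := q1 :: q)) => //=; rewrite ?cK // eq_sym //.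
  - exact: cK.
have euq1 : e q1 u by rewrite esym; case/andP: pq.
have q1SK : q1 \in S :\: K by apply: qSK; rewrite mem_head.
by rewrite (one _ _ _ q1SK uK z'K euq1 e1) eqxx in zu.
Qed.

Lemma barren_biclique_nbr t S A B q u w : max_degree e < t -> barren t S ->
    A \subset S -> B \subset S -> {in A & B, forall x y, e x y} ->
    1 < #|B| -> q \in S -> q \notin A -> q \notin B ->
    (exists2 z, z \in A & ~~ e q z) ->
  u \in A -> w \in A -> e q u -> e q w -> u = w.
Proof.
move=> tD bS AS BS AB B1 qS qA qB [z zA nqz] uA wA equ eqw.
apply/eqP; apply: contraT => uw; case/negP: (nqz).
have [b [b' [bB b'B bb']]] : exists b b', [/\ b \in B, b' \in B & b != b'].
  by have /card_gt1P[b [b' []]] := B1; exists b, b'.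
have nAB x y : x \in A -> y \in B -> x != y by move=> xA yB; apply/e_neq/AB.
have uz : u != z by apply: contraNneq nqz => <-.
have wz : w != z by apply: contraNneq nqz => <-.
have [qu qw qz] : [/\ q != u, q != w & q != z] by split; apply: contraNneq qA => ->.
have [qb qb'] : q != b /\ q != b' by split; apply: contraNneq qB => ->.
apply: (@barren_chord t S u q [:: w] b' z [:: b]) => //; last exact: AB.
- rewrite /= !inE !negb_or.
  do ?[apply/andP; split]; first [by [] | by rewrite eq_sym | exact: nAB | by rewrite eq_sym nAB].
- move=> v; rewrite !inE => /orP[/eqP->|/or4P[/eqP->|/eqP->|/eqP->|]] //;
    try exact: (subsetP AS); try exact: (subsetP BS).
  by case/orP => /eqP->; [exact: (subsetP AS)|exact: (subsetP BS)].
by rewrite /= esym equ eqw (AB w b') // esym (AB z b') // (AB z b) // esym AB.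
Qed.

Lemma barren_biclique_ear t S A B u w q1 q : max_degree e < t -> barren t S ->
    (forall x y z, x \in S -> y \in S -> z \in S -> e x y -> e y z -> e z x -> False) ->
    A \subset S -> B \subset S -> {in A & B, forall x y, e x y} ->
    1 < #|A| -> 1 < #|B| ->
    (forall z, z \in A :|: B -> e q1 z -> z = u) ->
    path e u (q1 :: q) -> e (last q1 q) w -> uniq (q1 :: q) ->
    {subset q1 :: q <= S :\: (A :|: B)} -> u != w -> u \in A -> w \in A :|: B ->
  False.
Proof.
move=> tD bS tri AS BS AB A1 B1 one pq lq Uq qSK uw uA wAB.
have nAB x y : x \in A -> y \in B -> x != y by move=> xA yB; apply/e_neq/AB.
have other (K : {set T}) x : 1 < #|K| -> exists2 y, y \in K & y != x.
  move=> /card_gt1P[y [z [yK zK yz]]]; have [E|] := eqVneq y x; last by exists y.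
  by exists z => //; rewrite -E eq_sym.
have qN v : v \in A :|: B -> v \notin q1 :: q.
  by move=> vK; apply/negP => /qSK /setDP[_ /negP].
have qS : {subset q1 :: q <= S} by move=> v /qSK /setDP[].
have sub (r : seq T) : {subset r <= A :|: B} -> {subset r <= S}.
  by move=> rK v /rK; rewrite inE => /orP[]; [apply: (subsetP AS)|apply: (subsetP BS)].
have ue : e q1 u by rewrite esym; case/andP: pq.
have [wB|wB] := boolP (w \in B).
  have [a' a'A a'u] := other A u A1; have [b' b'B b'w] := other B w B1.
  have rK : {subset [:: u; w; a'; b'] <= A :|: B}.
    by move=> v; rewrite !inE => /or4P[] /eqP->; rewrite ?uA ?wB ?a'A ?b'B ?orbT.
  have e1 : e q1 a'.
    apply: (@barren_chord t S u q1 q w a' [:: b']) => //; last exact: AB.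
    - apply: (uniq_insert (r := [:: w; a'; b'])) Uq _ => [|v vr]; last exact/qN/rK.
      rewrite /= !inE !negb_or.
      do ?[apply/andP; split]; first [by [] | by rewrite eq_sym | exact: nAB | by rewrite eq_sym nAB].
    - move=> v; rewrite in_cons -cat_cons mem_cat => /or3P[/eqP->|/qS//|vr].
        exact: (subsetP AS).
      by apply: (sub _ rK); rewrite inE vr orbT.
    - apply: (cycle_of_paths (p := q1 :: q)) => //=; last by rewrite esym AB.
      by rewrite esym AB //= AB.
  by rewrite (one a') ?inE ?a'A // eqxx in a'u.
have wA : w \in A by move: wAB; rewrite inE (negPf wB) orbF.
have /card_gt1P[b [b' [bB b'B bb']]] := B1.
have nqw : ~~ e q1 w by apply/negP => /(one _ wAB) E; rewrite E eqxx in uw.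
have AS' := subsetP AS; have BS' := subsetP BS.
have nbb x y : x \in B -> y \in B -> ~~ e x y.
  move=> xB yB; apply/negP => exy; have eyu : e y u by rewrite esym AB.
  exact: (tri u x y (AS' _ uA) (BS' _ xB) (BS' _ yB) (AB _ _ uA xB) exy eyu).
have rK : {subset [:: w; b; u; b'] <= A :|: B}.
  by move=> v; rewrite !inE => /or4P[] /eqP->; rewrite ?uA ?wA ?bB ?b'B ?orbT.
have U4 : uniq [:: w; b; u; b'].
  rewrite /= !inE !negb_or.
  do ?[apply/andP; split]; first [by [] | by rewrite eq_sym | exact: nAB | by rewrite eq_sym nAB].
pose s := [:: w, b & [::] ++ u :: q1 :: q].
have sE : perm_eq (s ++ [:: b']) ([:: w; b; u; b'] ++ q1 :: q).
  by rewrite /= !perm_cons -cat_cons cats1 perm_rcons.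
have Us : uniq (s ++ [:: b']).
  rewrite (perm_uniq sE) cat_uniq U4 Uq andbT; apply/hasPn => v vq.
  by apply: contraL vq => /rK/qN.
have cs : cycle e s.
  by rewrite /= -cats1 /= AB //= esym AB //= cat_path; move: pq => /= /andP[-> ->]; rewrite /= lq.
have U3 : uniq (w :: u :: [::]) by rewrite /= inE eq_sym uw.
apply: (bS _ _ _ (@ear_unique2 t w b [::] u q1 q b' [::] tD Us cs _ _ _ _)).
- apply/subsetP => v; rewrite inE (perm_mem sE) mem_cat.
  by move=> /orP[/(sub _ rK)|/qS].
- by apply/set0Pn; exists w; rewrite inE mem_head.
- by rewrite /= AB.
- by rewrite /= esym AB.
- move=> [|[|[|//]]] [|[|[|//]]] //= _ _ _; rewrite ?eirr ?nbb //.
- by move=> [|[|[|//]]].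
Qed.

Lemma barren_C4_free t S x a y b : max_degree e < t -> barren t S ->
    minimal_unique2 S -> x \in S -> a \in S -> y \in S -> b \in S ->
  e x a -> e a y -> e y b -> e b x -> x != y -> a != b -> False.
Proof.
move=> tD bS mS xS aS yS bS' exa eay eyb ebx xy ab; have [US minS] := mS.
have tri := fun x y z => @barren_triangle_free t S x y z tD bS mS.
pose bic A B := [&& 1 < #|A|, 1 < #|B| & [forall x in A, forall y in B, e x y]].
pose P (K : {set T}) := (K \subset S) && [exists A : {set T}, (A \subset K) && bic A (K :\: A)].
have bicU K A : K \subset S -> A \subset K -> bic A (K :\: A) -> P K.
  by move=> KS AK bAK; rewrite /P KS; apply/existsP; exists A; rewrite AK.
have nxa := e_neq exa; have nay := e_neq eay; have nyb := e_neq eyb; have nbx := e_neq ebx.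
have [K /maxsetP[/andP[KS /existsP[A /andP[AK bA]]] maxK] _] :
    {K | maxset P K & [set x; y] :|: [set a; b] \subset K}.
  apply: maxset_exists; apply: (bicU _ [set x; y]).
  - by rewrite !subUset !sub1set xS yS aS bS'.
  - exact: subsetUl.
  have -> : ([set x; y] :|: [set a; b]) :\: [set x; y] = [set a; b].
    apply/setP => v; rewrite !inE; case vxy: ((v == x) || (v == y)) => //=; symmetry; apply/negbTE.
    rewrite negb_or; case/orP: vxy => /eqP->; first by rewrite nxa eq_sym.
    by rewrite nyb eq_sym nay.
  rewrite /bic !cards2 xy ab; apply/forall_inP => u; rewrite !inE => u1.
  by apply/forall_inP => v; rewrite !inE; case/orP: u1 => /eqP-> /orP[] /eqP->; rewrite // esym.
pose B := K :\: A.
have KAB : A :|: B = K by rewrite /B -{1}(setIidPr AK) setID.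
have BK : B \subset K by apply: subsetDl.
have AS := subset_trans AK KS; have BS := subset_trans BK KS.
case/and3P: bA; rewrite -/B => A1 B1 AB.
have {}AB : {in A & B, forall x y, e x y}.
  by move=> u v uA vB; move/forall_inP: AB => /(_ _ uA)/forall_inP; apply.
have BA : {in B & A, forall x y, e x y} by move=> u v uB vA; rewrite esym AB.
have AS' := subsetP AS; have BS'' := subsetP BS.
have iA : {in A &, forall x y, ~~ e x y}.
  move=> u v uA vA; apply/negP => euv; have /card_gt0P[z zB] := ltnW B1.
  exact: (tri u v z (AS' _ uA) (AS' _ vA) (BS'' _ zB) euv (AB _ _ vA zB) (BA _ _ zB uA)).
have iB : {in B &, forall x y, ~~ e x y}.
  move=> u v uB vB; apply/negP => euv; have /card_gt0P[z zA] := ltnW A1.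
  exact: (tri u v z (BS'' _ uB) (BS'' _ vB) (AS' _ zA) euv (BA _ _ vB zA) (AB _ _ zA uB)).
have K1 : 1 < #|K| by apply: leq_trans (subset_leq_card AK).
have KpS : K \proper S.
  rewrite properEneq KS andbT; apply/eqP => E.
  case: US => c [d [pc _ fr]]; apply: biclique_not_forced pc _ _ AB iA iB fr.
    by rewrite KAB.
  by rewrite -card_gt0 ltnW.
have notall (q : T) (C D : {set T}) : q \in S -> q \notin K -> C :|: D = K -> D = K :\: C ->
    1 < #|C| -> 1 < #|D| -> {in C & D, forall x y, e x y} -> exists2 z, z \in C & ~~ e q z.
  move=> qS qK CD ED C1 D1 eCD.
  apply: contrapT => nex; have H v : v \in C -> e q v.
    by move=> vK; apply: contrapT => /negP nqv; apply: nex; exists v.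
  move: (qK); rewrite -(maxK (q |: K)) ?setU11 ?subsetUr //.
  apply: (bicU _ C); first by rewrite subUset sub1set qS.
    by rewrite -CD setUCA subsetUl.
  have -> : (q |: K) :\: C = q |: D.
    apply/setP => v; rewrite !inE ED inE; have [->|//] := eqVneq v q.
    by rewrite andbT; apply: contraNN qK => qC; rewrite -CD inE qC.
  rewrite /bic C1 (leq_trans D1) ?subset_leq_card ?subsetUr //=.
  apply/forall_inP => u uC; apply/forall_inP => v /setU1P[->|vD].
    by rewrite esym H.
  exact: eCD.
have DB : B = K :\: A by [].
have DA : A = K :\: B by rewrite /B setDDr setDv set0U (setIidPr AK).
have KBA : B :|: A = K by rewrite setUC.
have one q u w : q \in S :\: K -> u \in K -> w \in K -> e q u -> e q w -> u = w.
  case/setDP => qS qK; rewrite -KAB => uK wK equ eqw.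
  have [qA qB] : q \notin A /\ q \notin B.
    by apply/andP; rewrite -negb_or -in_setU KAB.
  have nA := notall q A B qS qK KAB DB A1 B1 AB.
  have nB := notall q B A qS qK KBA DA B1 A1 BA.
  case/setUP: uK => uX; case/setUP: wK => wX.
  - exact: (barren_biclique_nbr tD bS AS BS AB B1 qS qA qB nA).
  - by case: (tri q u w qS (AS' _ uX) (BS'' _ wX) equ (AB _ _ uX wX)); rewrite esym.
  - by case: (tri q u w qS (BS'' _ uX) (AS' _ wX) equ (BA _ _ uX wX)); rewrite esym.
  - exact: (barren_biclique_nbr tD bS BS AS BA A1 qS qB qA nB).
have [u [w [q1 [q [[uK wK uw] [pq lq Uq qSK]]]]]] := ear_exists US minS KpS K1.
have ue : e q1 u by rewrite esym; case/andP: pq.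
have q1S : q1 \in S :\: K by apply: qSK; rewrite mem_head.
have oneu z : z \in K -> e q1 z -> z = u by move=> zK ez; apply: one q1S zK uK ez ue.
move: (uK); rewrite -KAB => /setUP[uX|uX].
- apply: (@barren_biclique_ear t S A B u w q1 q); rewrite ?KAB //.
- apply: (@barren_biclique_ear t S B A u w q1 q); rewrite ?KBA //.
Qed.

Lemma perm_theta_r (a u w b : T) p s1 s2 :
  perm_eq ((a :: u :: p ++ w :: rev s1) ++ b :: s2) ((u :: a :: s1 ++ w :: b :: s2) ++ p).
Proof.
apply/permP => P; rewrite !(count_cat, cat_cons) /= !count_cat /= count_rev.
move: (nat_of_bool (P a)) (nat_of_bool (P u)) (nat_of_bool (P w)) (nat_of_bool (P b)).
by move: (count P p) (count P s1) (count P s2); lia.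
Qed.

Lemma perm_theta_l (a u w b : T) p s1 s2 :
  perm_eq ((u :: p ++ w :: b :: s2) ++ a :: s1) ((u :: a :: s1 ++ w :: b :: s2) ++ p).
Proof.
apply/permP => P; rewrite !(count_cat, cat_cons) /= !count_cat /=.
move: (nat_of_bool (P a)) (nat_of_bool (P u)) (nat_of_bool (P w)) (nat_of_bool (P b)).
by move: (count P p) (count P s1) (count P s2); lia.
Qed.

Lemma barren_no_chord t S x m y l : max_degree e < t -> barren t S ->
    minimal_unique2 S -> uniq (x :: m ++ y :: l) -> {subset x :: m ++ y :: l <= S} ->
    cycle e (x :: m ++ y :: l) -> e x y -> m = [::] \/ l = [::].
Proof.
move=> tD bS mS; case: m l => [|a m] [|b l]; [by left|by left|by right|].
move=> U sS cyc exy; have eab := barren_chord tD bS U sS cyc exy; exfalso.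
have exa : e x a by case/andP: cyc.
have eyb : e y b.
  have := next_cycle cyc (_ : y \in _); rewrite (@next_mid x (a :: m)) //; apply.
  by rewrite -cat_cons mem_cat mem_head orbT.
apply: (@barren_C4_free t S x a b y tD bS mS) => //.
- by apply: sS; rewrite mem_head.
- by apply: sS; rewrite !inE eqxx orbT.
- by apply: sS; rewrite -!cat_cons mem_cat !inE eqxx !orbT.
- by apply: sS; rewrite -!cat_cons mem_cat !inE eqxx !orbT.
- by rewrite esym.
- by rewrite esym.
- by apply: contraTneq U => ->; rewrite /= !inE mem_cat !inE eqxx !orbT.
- by apply: contraTneq U => ->; rewrite /= mem_cat !inE eqxx !orbT /= andbF.
Qed.

Lemma barren_chordless t S s x0 : max_degree e < t -> barren t S ->
    minimal_unique2 S -> uniq s -> {subset s <= S} -> cycle e s -> chordless x0 s.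
Proof.
move=> tD bS mS U sS cyc.
suff lt i j : i < j -> j < size s -> e (nth x0 s i) (nth x0 s j) ->
    j = i.+1 \/ i = 0 /\ j.+1 = size s.
  move=> i j li lj exy; have [ij|ji|E] := ltngtP i j.
  - by case: (lt i j) => //; [apply: Or41|apply: Or43].
  - by case: (lt j i) => //; [rewrite esym|apply: Or42|apply: Or44].
  - by rewrite E eirr in exy.
move=> ij lj exy; have li := ltn_trans ij lj.
pose m := take (j - i.+1) (drop i.+1 s).
have sE : rot i s = nth x0 s i :: m ++ nth x0 s j :: drop j.+1 s ++ take i s.
  rewrite /rot (drop_nth x0 li) cat_cons; congr (_ :: _).
  rewrite -{1}(cat_take_drop (j - i.+1) (drop i.+1 s)) -catA drop_drop subnK //.
  by rewrite (drop_nth x0 lj).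
have sub : {subset rot i s <= S} by move=> z; rewrite mem_rot; apply: sS.
have := @barren_no_chord t S (nth x0 s i) m (nth x0 s j) (drop j.+1 s ++ take i s) tD bS mS.
rewrite -sE rot_uniq rot_cycle => /(_ U sub cyc exy)[m0|l0].
- left; have : size m = 0 by rewrite m0.
  rewrite size_takel ?size_drop; move: ij lj; clear; lia.
right; have : size (drop j.+1 s ++ take i s) = 0 by rewrite l0.
rewrite size_cat size_drop size_takel; move: ij lj; clear; lia.
Qed.

Lemma path_rev_rcons u p w : path e u (rcons p w) = path e w (rcons (rev p) u).
Proof.
have := rev_path e u (rcons p w).
rewrite last_rcons belast_rcons rev_cons => ->.
by apply: eq_path => x y; rewrite esym.
Qed.

Lemma cycle_two_paths u p w r :
  cycle e (u :: p ++ w :: r) = path e u (rcons p w) && path e w (rcons r u).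
Proof. by rewrite /= rcons_cat rcons_cons -cat_rcons cat_path last_rcons. Qed.

Lemma barren_theta t S u a s1 w b s2 q1 q : max_degree e < t -> barren t S ->
    minimal_unique2 S -> uniq ((u :: a :: s1 ++ w :: b :: s2) ++ q1 :: q) ->
    {subset (u :: a :: s1 ++ w :: b :: s2) ++ q1 :: q <= S} ->
    cycle e (u :: a :: s1 ++ w :: b :: s2) ->
    path e u (q1 :: q) -> e (last q1 q) w -> s2 != [::] -> False.
Proof.
set p := q1 :: q; set s := u :: _.
move=> tD bS mS U sS cyc pp lp s20.
have chl s' x0 : uniq s' -> {subset s' <= S} -> cycle e s' -> chordless x0 s'.
  exact: barren_chordless tD bS mS.
have [pa pb] : path e u (rcons (a :: s1) w) /\ path e w (rcons (b :: s2) u).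
  by apply/andP; rewrite -cycle_two_paths.
have pr : path e u (rcons p w) by rewrite rcons_path pp.
pose s' := a :: u :: p ++ w :: rev s1.
have permE : perm_eq (s' ++ b :: s2) (s ++ p) by apply: perm_theta_r.
have [Us' s'S] : uniq s' /\ {subset s' <= S}.
  move: U; rewrite -(perm_uniq permE) cat_uniq => /andP[-> _]; split=> // z zs.
  by apply: sS; rewrite -(perm_mem permE) mem_cat zs.
have cs' : cycle e s'.
  rewrite -(rot_cycle 1) rot1_cons rcons_cons rcons_cat rcons_cons.
  by rewrite -rev_cons cycle_two_paths pr -path_rev_rcons.
pose f := u :: p ++ w :: b :: s2.
have permF : perm_eq (f ++ a :: s1) (s ++ p) by apply: perm_theta_l.
have [Uf fS] : uniq f /\ {subset f <= S}.
  move: U; rewrite -(perm_uniq permF) cat_uniq => /andP[-> _]; split=> // z zs.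
  by apply: sS; rewrite -(perm_mem permF) mem_cat zs.
have cf : cycle e f by rewrite cycle_two_paths pr.
have [Us sS'] : uniq s /\ {subset s <= S}.
  move: U; rewrite cat_uniq => /andP[-> _]; split=> // z zs.
  by apply: sS; rewrite mem_cat zs.
have ch1 := chl _ u Us' s'S cs'; have ch2 := chl _ u Uf fS cf.
have ch3 := chl _ u Us sS' cyc.
have sz1 : size s' = (size p + size s1).+3 by rewrite /s' /= size_cat /= size_rev !addnS.
have sz2 : size f = (size p + size s2).+3 by rewrite /f [LHS]/= size_cat /= !addnS.
have sz3 : size s = (size s1 + size s2).+4 by rewrite /s [LHS]/= size_cat /= !addnS.
have nth_s' i : i < (size p).+2 -> nth u (a :: u :: p) i = nth u s' i.
  by move=> li; rewrite /s' -!cat_cons nth_cat li.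
have nth_f i : i < (size p).+1 -> nth u (u :: p) i = nth u f i.
  by move=> li; rewrite /f -!cat_cons nth_cat li.
have f_b : nth u f (size p).+2 = b.
  by rewrite /f [LHS]/= nth_cat ltnNge leqnSn subSnn.
have s_b : nth u s (size s1).+3 = b.
  by rewrite /s [LHS]/= nth_cat ltnNge leqnSn subSnn.
have s2gt : 0 < size s2 by rewrite lt0n size_eq0.
apply: (bS _ _ _ (ear_unique2 tD U cyc pp lp _ _)).
- by apply/subsetP => z; rewrite inE; apply: sS.
- by apply/set0Pn; exists u; rewrite inE mem_head.
- move=> i j li lj O; apply/negP; rewrite !nth_s' // => exy.
  have := ch1 i j; rewrite sz1 => /(_ _ _ exy).
  move: (li : i < (size p).+2) (lj : j < (size p).+2) O; clear; move: (size p) (size s1) => n m li lj O.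
  move=> /(_ ltac:(lia) ltac:(lia))[E|E|[E F]|[E F]]; lia.
move=> [|i] li _; apply/negP => exy.
  have := ch3 (size s1).+3 1; rewrite sz3 s_b => /(_ _ _ exy).
  clear; move: (size s1) (size s2) => n m.
  by move=> /(_ ltac:(lia) ltac:(lia))[E|E|[E F]|[E F]]; lia.
have {}exy : e b (nth u f i) by rewrite -nth_f.
have := ch2 (size p).+2 i; rewrite sz2 f_b => /(_ _ _ exy).
move: (li : i < (size p).+1) s2gt; clear; move: (size p) (size s2) => n m li.
by move=> m0 /(_ ltac:(lia) ltac:(lia))[E|E|[E F]|[E F]]; lia.
Qed.


Lemma minimal_not_barren t S : max_degree e < t -> minimal_unique2 S ->
  S != set0 -> ~ barren t S.
Proof.
move=> tD mS S0 bS; have [[c [d [pc cd fr]]] minS] := mS; have [US _] := mS.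
have cdS : {in S, forall v, c v != d v} by move=> v /cd /and3P[].
have [||x [y [xS yS exy _]]] := fr S => //.
have xy := e_neq exy.
have K2 : 1 < #|[set x; y]| by rewrite cards2 xy.
have KpS : [set x; y] \proper S.
  rewrite properEneq subUset !sub1set xS yS !andbT; apply/eqP => E.
  apply: clique_not_forced pc S0 _ fr; rewrite -E => u v; rewrite !inE.
  by move=> /orP[]/eqP-> /orP[]/eqP->; rewrite ?eqxx // 1?esym.
have [u [w [q1 [q [[uK wK uw] [pq lq Uq qSK]]]]]] := ear_exists US minS KpS K2.
have ewu : e w u.
  by move: uK wK uw; rewrite !inE => /orP[]/eqP-> /orP[]/eqP->; rewrite ?eqxx // 1?esym.
pose s := u :: (q1 :: q) ++ [:: w].
have Us : uniq s.
  apply: (uniq_insert (r := [:: w])) Uq _ => [|v].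
    by rewrite /= inE uw.
  rewrite !inE => H; apply/negP => /qSK /setDP[_ /negP]; apply.
  by case/orP: H => /eqP->.
have cs : cycle e s by apply: cycle_of_paths; rewrite //= ewu.
have sS : {subset s <= S}.
  move=> v; rewrite in_cons mem_cat => /or3P[/eqP->|/qSK/setDP[]//|].
    exact: (subsetP (proper_sub KpS)).
  by rewrite inE => /eqP->; apply: (subsetP (proper_sub KpS)).
have slen : 2 < size s by rewrite /= size_cat addn1.
have sKS : [set z in s] \subset S by apply/subsetP => z; rewrite inE; apply: sS.
have sKpS : [set z in s] \proper S.
  rewrite properEneq sKS andbT; apply/eqP => E.
  apply: (chordless_cycle_not_forced Us slen cs _ _ pc cdS fr).
    move=> x0 k.
    have rS : {subset rot k s <= S} by move=> z; rewrite mem_rot; apply: sS.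
    have [rU rC] : uniq (rot k s) /\ cycle e (rot k s) by rewrite rot_uniq rot_cycle.
    exact: barren_chordless tD bS mS rU rS rC.
  by move=> z; rewrite -E inE.
have sK1 : 1 < #|[set z in s]|.
  by rewrite cardsE (card_uniqP Us) ltnW.
have [u' [w' [p1 [p [[us ws uw'] [pp lp Up pSK]]]]]] := ear_exists US minS sKpS sK1.
clearbody s; rewrite in_set in us; rewrite in_set in ws.
have [k r sE] := rot_to us.
have wr : w' \in r.
  by move: ws; rewrite -(mem_rot k) sE in_cons eq_sym (negPf uw').
case/splitPr: wr sE => r1 r2 sE.
have Us' : uniq (u' :: r1 ++ w' :: r2) by rewrite -sE rot_uniq.
have cs' : cycle e (u' :: r1 ++ w' :: r2) by rewrite -sE rot_cycle.
have sz : 2 < size (u' :: r1 ++ w' :: r2) by rewrite -sE size_rot.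
have s'S : {subset u' :: r1 ++ w' :: r2 <= S}.
  by move=> z; rewrite -sE mem_rot; apply: sS.
have pS : {subset p1 :: p <= S} by move=> z /pSK /setDP[].
have pN z : z \in u' :: r1 ++ w' :: r2 -> z \notin p1 :: p.
  rewrite -sE mem_rot => zs; apply/negP => /pSK.
  by rewrite in_setD in_set zs.
have {lp}pp : path e u' (rcons (p1 :: p) w') by rewrite rcons_path pp.
have [x' [p' rE]] : exists x' p', rev (p1 :: p) = x' :: p'.
  by case E: (rev (p1 :: p)) (size_rev (p1 :: p)) => [|x' p'] //; exists x', p'.
have rp : path e w' (rcons (x' :: p') u') by rewrite -rE -path_rev_rcons.
have Ur : uniq (x' :: p') by rewrite -rE rev_uniq.
have rS : {subset x' :: p' <= S} by move=> z; rewrite -rE mem_rev; apply: pS.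
have rN z : z \in u' :: r1 ++ w' :: r2 -> z \notin x' :: p'.
  by rewrite -rE mem_rev; apply: pN.
have wsE : w' :: r2 ++ u' :: r1 = rot (size (u' :: r1)) (u' :: r1 ++ w' :: r2).
  by rewrite -cat_cons rot_size_cat.
have Uws : uniq (w' :: r2 ++ u' :: r1) by rewrite wsE rot_uniq.
have cws : cycle e (w' :: r2 ++ u' :: r1) by rewrite wsE rot_cycle.
have mws z : (z \in w' :: r2 ++ u' :: r1) = (z \in u' :: r1 ++ w' :: r2).
  by rewrite wsE mem_rot.
have edge_ear (v v' x0 : T) l l' : uniq (v :: v' :: x0 :: l) ->
    {subset v :: v' :: x0 :: l <= S} -> cycle e (v :: v' :: x0 :: l) ->
    path e v (rcons l' v') -> uniq l' -> {subset l' <= S} ->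
    (forall z, z \in v :: v' :: x0 :: l -> z \notin l') -> l' != [::] -> False.
  move=> U sub cyc pl Ul lS lN l0.
  have vv' : e v v' by case/andP: cyc.
  case: (@barren_no_chord t S v l' v' (x0 :: l) tD bS mS _ _ _ vv') => //.
  - exact: uniq_insert.
  - move=> z; rewrite in_cons mem_cat => /or3P[zv|/lS//|zl]; apply: sub.
      by rewrite in_cons zv.
    by rewrite in_cons zl orbT.
  - by rewrite cycle_two_paths pl; case/andP: cyc.
  - by move=> E; rewrite E in l0.
have uniq_ear (l l' : seq T) : uniq l -> uniq l' -> (forall z, z \in l -> z \notin l') ->
    uniq (l ++ l').
  move=> Ul Ul' N; rewrite cat_uniq Ul Ul' andbT.
  by apply/hasPn => z zl'; apply/negP => /N; rewrite zl'.
case: r1 r2 Us' cs' sz s'S pN rN Uws cws mws {sE wsE}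
    => [|a s1] [|b s2] Us' cs' sz s'S pN rN Uws cws mws //.
- exact: (edge_ear u' w' b s2 (p1 :: p)).
- have wS : {subset w' :: u' :: a :: s1 <= S} by move=> z; rewrite mws; apply: s'S.
  apply: (edge_ear w' u' a s1 (x' :: p')) => // z.
  by rewrite mws; apply: rN.
have [s20|s20] := eqVneq s2 [::]; last first.
  move: pp; rewrite rcons_path => /andP[pp lp].
  apply: (@barren_theta t S u' a s1 w' b s2 p1 p) => //; first exact: uniq_ear.
  by move=> z; rewrite mem_cat => /orP[/s'S|/pS].
have [s10|s10] := eqVneq s1 [::]; last first.
  move: rp; rewrite rcons_path => /andP[rp lp].
  apply: (@barren_theta t S w' b s2 u' a s1 x' p') => //.
    by apply: uniq_ear => // z; rewrite mws; apply: rN.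
  by move=> z; rewrite mem_cat mws => /orP[/s'S|/rS].
move: cs' Us' s'S; rewrite s10 s20 => /and5P[ua aw wb bu _] Us' s'S.
apply: (@barren_C4_free t S u' a w' b) => //; try by apply: s'S; rewrite !inE eqxx ?orbT.
by move: Us'; rewrite /= !inE !negb_or => /and4P[_ /andP[]].
Qed.

Lemma unique2_below_subset t S : max_degree e < t -> unique2 predT S -> S != set0 ->
  exists A, [/\ A \subset S, A != set0 & unique2 (gtn t) A].
Proof.
move=> tD US S0.
have [M /minsetP[/andP[M0 /asboolP UM] minM] MS] :
    {M | minset (fun A => (A != set0) && `[< unique2 predT A >]) M & M \subset S}.
  by apply: minset_exists; rewrite S0; apply/asboolP.
have mM : minimal_unique2 M.
  split=> // A /properP[AM [x xM xA]] A0 UA.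
  by move: xA; rewrite (minM A) ?xM // A0; apply/asboolP.
apply: contrapT => nex; apply: (minimal_not_barren tD mM M0) => A AM A0 UA.
by apply: nex; exists A; split=> //; apply: subset_trans MS.
Qed.

Lemma unique2_below_setT t : max_degree e < t -> unique2 predT [set: T] ->
  unique2 (gtn t) [set: T].
Proof.
move=> tD UT.
have [S /maxsetP[/asboolP US maxS] _] :
    {S | maxset (fun A => `[< unique2 (gtn t) A >]) S & set0 \subset S}.
  apply: maxset_exists; apply/asboolP; exists (fun=> 0), (fun=> 0).
  split=> [u v|v|X]; rewrite ?inE // subset0 => /eqP->.
  by rewrite eqxx.
have [->//|ST] := eqVneq [set: T] S.
have nadj u v : u \in S -> v \notin S -> ~~ e u v.
  move=> uS vS; apply/negP => euv; move: (vS).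
  rewrite -(maxS (v |: S)) ?setU11 ?subsetUr //; apply/asboolP.
  exact: unique2_add uS vS euv.
have UC : unique2 predT (~: S).
  apply: unique2_sep UT (subsetT _) _ => u v; rewrite !inE => uS /andP[+ _].
  by rewrite negbK => vS; rewrite esym nadj.
have C0 : ~: S != set0 by apply: contraNneq ST => C0; rewrite -[S]setCK C0 setC0.
have [A [AC A0 UA]] := unique2_below_subset tD UC C0.
have [x xA] := set0Pn _ A0.
have /negP[] : x \notin S by move/subsetP: AC => /(_ _ xA); rewrite inE.
rewrite -(maxS (S :|: A)) ?subsetUl ?inE ?xA ?orbT //; apply/asboolP.
apply: unique2_setU => // u v uS vA.
have vS : v \notin S by move/subsetP: AC => /(_ _ vA); rewrite inE.
by split; [apply: contraNneq vS => <-|apply: nadj].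
Qed.

Lemma UkLC2_unique2 : UkLC e 2 -> unique2 predT [set: T].
Proof.
move=> [L [kL [c [[cL ce] cU]]]].
have exd v : exists b, b \in L v /\ c v != b.
  have /fset0Pn[b] : (L v `\ c v != fset0)%fset.
    by rewrite -cardfs_gt0; move: (kL v); rewrite (cardfsD1 (c v)) cL add1n => -[->].
  by rewrite !inE => /andP[bc bL]; exists b; rewrite eq_sym.
have [d dP] := boolp.choice exd.
exists c, d; split=> [u v _ _ euv|v _|X _ /set0Pn[x xX]].
- exact/eqP/ce.
- by case: (dP v).
apply: contrapT => nex.
pose c' := [ffun v => if v \in X then d v else c v].
suff pc' : proper_list_coloring e L c'.
  have [_ /eqP[]] := dP x.
  by rewrite {1}(cU _ pc') ffunE xX.
split=> [v|u v euv]; rewrite !ffunE; first by case: ifP => _; [case: (dP v)|].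
case uX: (u \in X); first by move=> E; apply: nex; exists u, v.
case vX: (v \in X); last exact: ce.
by move=> E; apply: nex; exists v, u; rewrite uX esym; split.
Qed.

Lemma unique2_UktLC t : unique2 (gtn t) [set: T] -> UktLC e 2 t.
Proof.
move=> [c [d [pc cd fr]]].
have {}cd v : [/\ c v < t, d v < t & c v != d v] by apply/and3P/cd.
exists (fun v => [fset c v; d v]%fset); split.
- by move=> v; have [_ _ ne] := cd v; rewrite cardfs2 ne.
- have sub : (\bigcup_(v in T) [fset c v; d v] `<=` [fset i in iota 0 t])%fset.
    apply/fsubsetP => i /bigfcupP[v _]; have [ct dt _] := cd v.
    by rewrite !inE mem_iota => /orP[]/eqP->.
  apply: leq_trans (fsubset_leq_card sub) _.
  by rewrite card_fseq undup_id ?iota_uniq // size_iota.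
have cE v : ([ffun v => c v] : {ffun T -> nat}) v = c v by rewrite ffunE.
exists [ffun v => c v]; split.
  split=> [v|u v euv]; rewrite !ffunE ?inE ?eqxx //.
  by apply/eqP/pc; rewrite ?inE.
move=> c' [c'L c'e].
have [X0|X0] := eqVneq [set v | c' v != c v] set0.
  apply/ffunP => v; rewrite ffunE; symmetry; apply/eqP.
  by move/setP/(_ v): X0; rewrite !inE => /negbFE.
have c'E v : c' v = if v \in [set v | c' v != c v] then d v else c v.
  rewrite inE; have [//|ne] := eqVneq (c' v) (c v).
  by move: (c'L v); rewrite !inE (negPf ne) => /eqP.
have [u [v [uX _ euv E]]] := fr _ (subsetT _) X0.
by case: (c'e u v euv); rewrite (c'E u) uX E -c'E.
Qed.

Lemma UktLC1_greedy t : max_degree e < t -> UktLC e 1 t.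
Proof.
move=> tD; have [||c [pc ct _]] := @greedy_extend t set0 (fun=> 0) tD.
- by move=> u v; rewrite inE.
- by move=> v; rewrite inE.
exists (fun v => [fset c v]%fset); split.
- by move=> v; rewrite cardfs1.
- have sub : (\bigcup_(v in T) [fset c v] `<=` [fset i in iota 0 t])%fset.
    apply/fsubsetP => i /bigfcupP[v _].
    by rewrite !inE mem_iota => /eqP->; apply: ct.
  apply: leq_trans (fsubset_leq_card sub) _.
  by rewrite card_fseq undup_id ?iota_uniq // size_iota.
exists [ffun v => c v]; split.
  split=> [v|u v euv]; rewrite !ffunE ?inE ?eqxx //.
  exact/eqP/pc.
move=> c' [c'L _]; apply/ffunP => v; rewrite ffunE.
by move: (c'L v); rewrite inE => /eqP.
Qed.

End TwoLists.

(** * Lists of size at least three *)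

Section Nullstellensatz.

Import Order.TTheory GRing.Theory Num.Theory.
Local Open Scope ring_scope.

Context (T : finType) (e : rel T).
Hypothesis esym : symmetric e.
Hypothesis eirr : irreflexive e.

(* These weights annihilate the polynomials of degree at most 1 on a 3-element
   set: up to a common factor they are its Lagrange weights. *)
Definition lweight (x : 'I_3 -> int) (i : 'I_3) : int := x (i + 1) - x (i - 1).

Lemma lweight_sum (x : 'I_3 -> int) m : (m < 2)%N ->
  \sum_i lweight x i * x i ^+ m = 0.
Proof.
have E : (forall j : 'I_3, [\/ j = 0, j = 1 | j = -1]) by
  case=> [[|[|[|//]]] lj]; [apply: Or31|apply: Or32|apply: Or33]; apply: val_inj.
have [a0 a1 a2] : [/\ (0 + 1 : 'I_3) = 1, (1 + 1 : 'I_3) = -1 & (-1 + 1 : 'I_3) = 0].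
  by split; apply: val_inj.
have [b0 b1 b2] : [/\ (0 - 1 : 'I_3) = -1, (1 - 1 : 'I_3) = 0 & (-1 - 1 : 'I_3) = 1].
  by split; apply: val_inj.
have [o0 o1 o2] : [/\ (ord0 : 'I_3) = 0, (lift ord0 ord0 : 'I_3) = 1
    & (lift ord0 (lift ord0 ord0) : 'I_3) = -1].
  by split; apply: val_inj.
rewrite !big_ord_recl big_ord0 o0 o1 o2 /lweight a0 a1 a2 b0 b1 b2.
by case: m => [|[|//]] _; ring.
Qed.

Lemma grid_sum0 (x : T -> 'I_3 -> int) (l : seq (T * T)) (m : T -> nat) :
    (\sum_v m v + size l < 2 * #|T|)%N ->
  \sum_(f : {ffun T -> 'I_3}) (\prod_v (lweight (x v) (f v) * x v (f v) ^+ m v)) *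
     \prod_(o <- l) (x o.1 (f o.1) - x o.2 (f o.2)) = 0.
Proof.
elim: l m => [|[u v] l IH] m /= lt.
  under eq_bigr do rewrite big_nil mulr1.
  rewrite -(bigA_distr_bigA (fun v i => lweight (x v) i * x v i ^+ m v)).
  have [v lv] : exists v, (m v < 2)%N.
    apply: contrapT => nex; move: lt; rewrite addn0 ltnNge => /negP; apply.
    rewrite mulnC -sum_nat_const; apply: leq_sum => v _.
    by rewrite leqNgt; apply/negP => lv; apply: nex; exists v.
  by rewrite (bigD1 v) //= lweight_sum // mul0r.
pose bump u w := (m w + (w == u))%N.
have bumpE z (f : {ffun T -> 'I_3}) :
    \prod_v (lweight (x v) (f v) * x v (f v) ^+ bump z v) =
    (\prod_v (lweight (x v) (f v) * x v (f v) ^+ m v)) * x z (f z).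
  rewrite (bigD1 z) //= [in RHS](bigD1 z) //= {1}/bump eqxx addn1 exprSr.
  rewrite (eq_bigr (fun w => lweight (x w) (f w) * x w (f w) ^+ m w)); first by ring.
  by move=> w wz; rewrite /bump (negPf wz) addn0.
have ltb z : (\sum_v bump z v + size l < 2 * #|T|)%N.
  rewrite big_split /= -big_mkcond /= big_pred1_eq -addnA add1n.
  exact: lt.
have := congr2 (fun a b => a - b) (IH _ (ltb u)) (IH _ (ltb v)).
rewrite subr0 -sumrB => E; rewrite -[RHS]E; apply: eq_bigr => f _.
by rewrite !bumpE big_cons /=; ring.
Qed.

Definition edge_seq :=
  [seq p <- enum {: T * T} | e p.1 p.2 && (enum_rank p.1 < enum_rank p.2)%N].

Lemma size_edge_seq : (\sum_v degree e v = 2 * size edge_seq)%N.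
Proof.
have -> : (\sum_v degree e v = \sum_(p : T * T | e p.1 p.2) 1)%N.
  rewrite -(pair_big_dep predT (fun u v => e u v) (fun _ _ => 1%N)) /=.
  by apply: eq_bigr => v _; rewrite sum1dep_card.
rewrite (bigID (fun p : T * T => (enum_rank p.1 < enum_rank p.2)%N)) /=.
have -> : (\sum_(p : T * T | e p.1 p.2 && ~~ (enum_rank p.1 < enum_rank p.2)) 1 =
   \sum_(p : T * T | e p.1 p.2 && (enum_rank p.1 < enum_rank p.2)) 1)%N.
  rewrite (reindex_inj (h := fun p : T * T => (p.2, p.1))); last by move=> [a b] [c d] /= [-> ->].
  apply: eq_bigl => -[u v] /=; rewrite esym; case euv: (e u v) => //=.
  rewrite -leqNgt ltn_neqAle; case: eqP => // /val_inj/enum_rank_inj uv.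
  by rewrite uv eirr in euv.
by rewrite addnn -mul2n sum1_card size_filter -sum1_count -sum1_card big_enum_cond.
Qed.

Lemma isolated_grid_point (x : T -> 'I_3 -> int) :
    (forall v, injective (x v)) -> (forall u v, e u v -> x u 0 != x v 0) ->
    (forall f : {ffun T -> 'I_3}, (exists v, f v != 0) ->
       exists u v, e u v /\ x u (f u) = x v (f v)) ->
  (4 * #|T| <= \sum_v degree e v)%N.
Proof.
move=> xinj x0 xf; rewrite size_edge_seq leqNgt; apply/negP => lt.
have := @grid_sum0 x edge_seq (fun=> 0%N); rewrite big1 // add0n.
move=> /(_ ltac:(lia)) /eqP; apply/negP.
rewrite (bigD1 [ffun=> 0]) //= [X in _ + X]big1 ?addr0.
  rewrite mulf_neq0 //.
    apply/prodf_neq0 => v _; rewrite expr0 mulr1 subr_eq0 inj_eq //.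
    by rewrite ffunE.
  rewrite prodf_seq_neq0; apply/allP => -[u v]; rewrite mem_filter /= => /andP[/andP[euv _] _].
  by rewrite !ffunE subr_eq0 x0.
move=> f f0; have [|u [v [euv E]]] := xf f.
  apply: contrapT => nex; move/eqP: f0; apply; apply/ffunP => v; rewrite ffunE.
  by apply/eqP; apply: contrapT => /negP fv; apply: nex; exists v.
apply/eqP; rewrite mulf_eq0 [X in _ || X]prodf_seq_eq0; apply/orP; right.
have [lt_uv|lt_vu|/val_inj/enum_rank_inj uv] := ltngtP (enum_rank u) (enum_rank v).
- apply/hasP; exists (u, v); first by rewrite mem_filter /= euv lt_uv mem_enum.
  by rewrite /= E subrr.
- apply/hasP; exists (v, u); first by rewrite mem_filter /= esym euv lt_vu mem_enum.
  by rewrite /= E subrr.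
- by rewrite uv eirr in euv.
Qed.

Lemma UkLC_ge3 k : (2 < k)%N -> UkLC e k -> (4 * #|T| <= \sum_v degree e v)%N.
Proof.
move=> k3 [L [kL [c [[cL ce] cU]]]].
pose s v : seq nat := c v :: enum_fset (L v `\ c v)%fset.
have szs v : size (s v) = k.
  by rewrite /= -(kL v) (cardfsD1 (c v) (L v)) cL.
have Us v : uniq (s v).
  by rewrite /= fset_uniq andbT; apply/negP; rewrite -[_ \in _]/(c v \in (L v `\ c v)%fset) !inE eqxx.
have sL v a : a \in s v -> a \in L v.
  rewrite in_cons => /predU1P[->//|].
  by rewrite -[_ \in _]/(a \in (L v `\ c v)%fset) !inE => /andP[].
have lt v (i : 'I_3) : (i < size (s v))%N by rewrite szs; apply: leq_trans k3.
apply: (@isolated_grid_point (fun v i => (nth 0%N (s v) i)%:Z)).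
- move=> v i j [] /eqP; rewrite nth_uniq ?lt // => /eqP; exact: val_inj.
- move=> u v euv; rewrite /= eqz_nat; exact/eqP/ce.
move=> f [w fw]; apply: contrapT => nex.
pose c' := [ffun v => nth 0%N (s v) (f v)].
have : proper_list_coloring e L c'.
  split=> [v|u v euv]; rewrite !ffunE; first by apply: sL; rewrite mem_nth ?lt.
  by move=> E; apply: nex; exists u, v; rewrite E.
move=> /cU /ffunP /(_ w); rewrite ffunE -[LHS]/(nth 0%N (s w) 0) => /eqP.
rewrite nth_uniq ?lt // => /eqP E.
by case/eqP: fw; apply: val_inj.
Qed.

End Nullstellensatz.

Theorem corollary5 (T : finType) (e : rel T)
    (hsym : symmetric e) (hirr : irreflexive e) (hne : 0 < #|T|)
    (havg : (avg_degree e < 4)%R) :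
  chi_u e <= (max_degree e).+1.
Proof.
have deg4 : \sum_v degree e v < 4 * #|T|.
  move: havg; rewrite /avg_degree Num.Theory.ltr_pdivrMr ?Num.Theory.ltr0n //.
  by rewrite -GRing.natrM Num.Theory.ltr_nat.
rewrite /chi_u; case: ex_maxnP => m /asboolP[k k0 <-] _.
rewrite /chi_u_k; case: pselect => // Uk; case: ex_minnP => t _; apply.
apply/asboolP; case: k k0 Uk => [|[|[|k]]] // _ Uk.
- exact: UktLC1_greedy.
- by apply/unique2_UktLC/unique2_below_setT/UkLC2_unique2.
- by have := UkLC_ge3 hsym hirr (isT : 2 < k.+3) Uk; rewrite leqNgt => /negP.
Qed.
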